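(* For all integers $n,m$ with $1\le m\le n$, there exist a circuit $\mathcal{C}\subset\mathbb{Z}^n$ with $m(\mathcal{C})=m$ and a generic real polynomial system supported on $\mathcal{C}$ having exactly $m+1$ positive solutions.
   Context: A circuit is a set $\mathcal{C}\subset\mathbb{Z}^n$ of $n+2$ points whose affine span is $\mathbb{R}^n$; it contains a unique minimal affinely dependent subset, and $m(\mathcal{C})$ denotes the dimension of the affine span of that subset. A real polynomial system supported on $\mathcal{C}$ is a system of $n$ Laurent polynomial equations $F_1=\dots=F_n=0$ in $x=(x_1,\dots,x_n)$ with real coefficients, where each $F_j$ has support $\mathcal{C}$ (the set of exponent vectors of its monomials with nonzero coefficient). Such a system is generic if its number of solutions in $(\mathbb{C}^* )^n$ equals the normalized volume $v(\mathcal{C})$ of the convex hull of $\mathcal{C}$ (normalized so that $[0,1]^n$ has volume $n!$). Positive solutions are solutions in $(\mathbb{R}_{>0})^n$. *)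

(* Defs.v *)
From HB Require Import structures.
From mathcomp Require Import all_boot all_order all_algebra.
From mathcomp Require Import complex.
From mathcomp Require Import boolp classical_sets reals topology normedtype sequences.
Set Implicit Arguments. Unset Strict Implicit. Unset Printing Implicit Defensive.
Import Order.TTheory GRing.Theory Num.Theory.
Import numFieldTopology.Exports numFieldNormedType.Exports.
Local Open Scope ring_scope.
Local Open Scope classical_set_scope.
Local Open Scope ring_scope.

Definition ptQ (n : nat) (a : 'rV[int]_n) : 'rV[rat]_n := map_mx (fun z : int => z%:~R) a.

Definition affdim (n k : nat) (p : 'I_k -> 'rV[int]_n) (D : {set 'I_k}) : int :=
  match [pick i in D] with
  | None => -1
  | Some i0 =>
      (\rank (\matrix_(i < k) (if i \in D then ptQ (p i) - ptQ (p i0) else 0)))%:Z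
  end.

Definition aff_dep (n k : nat) (p : 'I_k -> 'rV[int]_n) (D : {set 'I_k}) : Prop :=
  exists l : 'I_k -> rat,
    (exists2 i, i \in D & l i != 0) /\
    (forall i, i \notin D -> l i = 0) /\
    \sum_(i < k) l i = 0 /\
    \sum_(i < k) l i *: ptQ (p i) = 0.

Definition min_aff_dep (n k : nat) (p : 'I_k -> 'rV[int]_n) (D : {set 'I_k}) : Prop :=
  aff_dep p D /\ (forall D' : {set 'I_k}, D' \proper D -> ~ aff_dep p D').

Definition is_circuit (n : nat) (p : 'I_n.+2 -> 'rV[int]_n) : Prop :=
  injective p /\ affdim p [set: 'I_n.+2] = n%:Z.

Definition circuit_m (n : nat) (p : 'I_n.+2 -> 'rV[int]_n) (m : nat) : Prop :=
  exists D : {set 'I_n.+2},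
    min_aff_dep p D /\ (forall D', min_aff_dep p D' -> D' = D) /\ affdim p D = m%:Z.

Definition in_conv (n k : nat) (p : 'I_k -> 'rV[int]_n) (y : 'rV[rat]_n) : Prop :=
  exists l : 'I_k -> rat,
    (forall i, 0 <= l i) /\ \sum_(i < k) l i = 1 /\ \sum_(i < k) l i *: ptQ (p i) = y.

Definition coord_bound (n k : nat) (p : 'I_k -> 'rV[int]_n) : nat :=
  \max_(i < k) \max_(j < n) absz (p i ord0 j).

(* number of z in Z^n with z / K in conv(p) (all such z satisfy |z_j| <= B K) *)
Definition grid_count (n k : nat) (p : 'I_k -> 'rV[int]_n) (K : nat) : nat :=
  let B := coord_bound p in
  #|[set f : {ffun 'I_n -> 'I_(2 * B * K).+1} |
      `[< in_conv p (\row_j (((f j)%:Z - (B * K)%:Z)%:~R / K%:R)) >] ]|.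

(* normalized volume: n! vol(conv C), vol = lim_K #(conv C ∩ (1/K) Z^n) / K^n *)
Definition normalized_volume (R : realType) (n k : nat) (p : 'I_k -> 'rV[int]_n) : R :=
  lim ((fun K : nat => ((n`! * grid_count p K.+1)%:R / (K.+1)%:R ^+ n : R)) @ \oo).

Definition lmono (F : fieldType) (n : nat) (x : 'rV[F]_n) (a : 'rV[int]_n) : F :=
  \prod_(j < n) (x 0 j) ^ (a 0 j).

Definition sys_eval (F : fieldType) (n k : nat) (p : 'I_k -> 'rV[int]_n)
    (c : 'M[F]_(n, k)) (x : 'rV[F]_n) (j : 'I_n) : F :=
  \sum_(i < k) c j i * lmono x (p i).

(* each F_j has support exactly {p i}: all coefficients nonzero (p injective) *)
Definition supported_on (R : realType) (n k : nat) (c : 'M[R]_(n, k)) : Prop :=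
  forall j i, c j i != 0.

Definition csol (R : realType) (n k : nat) (p : 'I_k -> 'rV[int]_n)
    (c : 'M[R]_(n, k)) (x : 'rV[R[i]]_n) : Prop :=
  (forall j, x 0 j != 0) /\
  (forall j, sys_eval p (map_mx (fun r : R => (r%:C)%C) c) x j = 0).

Definition possol (R : realType) (n k : nat) (p : 'I_k -> 'rV[int]_n)
    (c : 'M[R]_(n, k)) (x : 'rV[R]_n) : Prop :=
  (forall j, 0 < x 0 j) /\ (forall j, sys_eval p c x j = 0).

Definition generic_system (R : realType) (n k : nat) (p : 'I_k -> 'rV[int]_n)
    (c : 'M[R]_(n, k)) : Prop :=
  exists s : seq 'rV[R[i]]_n,
    uniq s /\ (forall x, x \in s <-> csol p c x) /\
    (size s)%:R = normalized_volume R p.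

Definition num_pos_sol (R : realType) (n k : nat) (p : 'I_k -> 'rV[int]_n)
    (c : 'M[R]_(n, k)) (N : nat) : Prop :=
  exists s : seq 'rV[R]_n,
    uniq s /\ (forall x, x \in s <-> possol p c x) /\ size s = N.

(* Main.v *)
(** The circuit consists of 0, e_1, ..., e_n and w = 2 e_1 - 2 e_2 + 2 e_3 - ...
    (m nonzero terms).  Up to an invertible combination of its equations the
    system is x_k = 1 + d_k t with t = x^w, so its solutions are the roots of
    t (1 + d_2 t)^2 (1 + d_4 t)^2 ... = (1 + d_1 t)^2 (1 + d_3 t)^2 ..., an equation
    of degree m+1.  Multiplying one side by a new factor (1 + d t)^2 with d > 0
    small keeps the existing sign changes and creates one more near infinity,
    so by induction the d_k can be chosen so that all m+1 roots are positive
    and simple; then every complex solution is positive as well.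

    The normalized volume is m+1 too, being the sum of the positive coefficients
    of the affine relation of the circuit: the simplices obtained by deleting
    one point of positive coefficient triangulate the convex hull, and their
    lattice points are counted by compositions of integers. *)
Require Import Defs.
From HB Require Import structures.
From mathcomp Require Import all_boot all_order all_algebra.
From mathcomp Require Import complex.
From mathcomp Require Import boolp classical_sets reals topology normedtype sequences.
From mathcomp Require Import realfun polyrcf zify ring lra.
Import Order.TTheory GRing.Theory Num.Theory.
Import numFieldTopology.Exports numFieldNormedType.Exports.
Local Open Scope ring_scope.

Set Implicit Arguments.
Unset Strict Implicit.
Unset Printing Implicit Defensive.

(** * The circuit *)

Section Circuit.
Variable n : nat.

(** Index layout: [ord0] is the origin, [mid_pt k] the unit vector $e_k$, and [ord_max] the point w
    with coordinates [mu]. *)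
Definition mid_pt (k : 'I_n) : 'I_n.+2 := lift ord0 (widen_ord (leqnSn n) k).

Definition glue (T : Type) (a : T) (f : 'I_n -> T) (b : T) (i : 'I_n.+2) : T :=
  if unlift ord0 i is Some i' then
    if unlift ord_max i' is Some k then f k else b
  else a.

Lemma widen_lift_max (k : 'I_n) : widen_ord (leqnSn n) k = lift ord_max k.
Proof. by apply/val_inj; rewrite /= /bump leqNgt ltn_ord. Qed.

Lemma ord_max_lift : ord_max = lift ord0 ord_max :> 'I_n.+2.
Proof. exact/val_inj. Qed.

Lemma glue0 T (a : T) f b : glue a f b ord0 = a.
Proof. by rewrite /glue unlift_none. Qed.

Lemma glue_mid T (a : T) f b k : glue a f b (mid_pt k) = f k.
Proof. by rewrite /glue liftK widen_lift_max liftK. Qed.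

Lemma glue_max T (a : T) f b : glue a f b ord_max = b.
Proof. by rewrite /glue ord_max_lift liftK unlift_none. Qed.

Definition glueE := (glue0, glue_mid, glue_max).

Lemma pt_ind (P : 'I_n.+2 -> Prop) :
  P ord0 -> (forall k, P (mid_pt k)) -> P ord_max -> forall i, P i.
Proof.
move=> P0 Pk Pm i; have [i' ->|-> //] := unliftP ord0 i.
have [k ->|->] := unliftP ord_max i'; last by rewrite -ord_max_lift.
by rewrite -widen_lift_max; apply: Pk.
Qed.

Lemma sum_pt (V : nmodType) (F : 'I_n.+2 -> V) :
  \sum_i F i = F ord0 + (\sum_k F (mid_pt k) + F ord_max).
Proof. by rewrite big_ord_recl big_ord_recr -ord_max_lift. Qed.

Lemma mid_pt_eq_max k : (mid_pt k == ord_max) = false.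
Proof. by apply/negbTE; rewrite -val_eqE /= /bump /= add1n eqSS neq_ltn ltn_ord. Qed.

Lemma mid_pt_inj : injective mid_pt.
Proof. by move=> k l /lift_inj /(congr1 val) /= /val_inj. Qed.

Variable mu : 'I_n -> int.

Definition cpt : 'I_n.+2 -> 'rV[int]_n := glue 0 (delta_mx 0) (\row_k mu k).

(** The integral affine relation among the points, normalized to coefficient 1 at w. *)
Definition crel : 'I_n.+2 -> int :=
  glue (\sum_k mu k - 1) (fun k => - mu k) 1.

Lemma sum_cpt (c : 'I_n.+2 -> rat) k :
  (\sum_i c i *: ptQ (cpt i)) 0 k = c (mid_pt k) + c ord_max * (mu k)%:~R.
Proof.
rewrite summxE sum_pt /cpt !glueE !mxE mulr0 add0r; congr (_ + _).
rewrite (bigD1 k) //= glueE !mxE !eqxx mulr1 big1 ?addr0 // => i ik.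
by rewrite glueE !mxE eqxx /= eq_sym (negbTE ik) mulr0.
Qed.

(** The coordinate equations force the coefficients of the unit vectors, and the zero sum then
    forces that of the origin. The ring is general because rational and integer relations both occur
    below. *)
Lemma crel_unique (F : comNzRingType) (c : 'I_n.+2 -> F) :
  \sum_i c i = 0 -> (forall k, c (mid_pt k) + c ord_max * (mu k)%:~R = 0) ->
  forall i, c i = c ord_max * (crel i)%:~R.
Proof.
move=> c0 cm; have cmE k : c (mid_pt k) = - (c ord_max * (mu k)%:~R).
  by apply/eqP; rewrite -addr_eq0 cm.
apply: pt_ind => [|k|]; rewrite /crel glueE ?mulr1 //.
  move: c0; rewrite sum_pt (eq_bigr _ (fun k _ => cmE k)) sumrN -mulr_sumr.
  rewrite intrB rmorph_sum /= => /eqP; rewrite addr_eq0 => /eqP ->.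
  by ring.
by rewrite cmE rmorphN /= mulrN.
Qed.

Lemma sum_crel : \sum_i crel i = 0.
Proof.
rewrite sum_pt (eq_bigr (fun k => - mu k)) => [|k _]; last by rewrite /crel glueE.
by rewrite /crel !glueE sumrN; ring.
Qed.

Lemma crel_mid k : crel (mid_pt k) + mu k = 0.
Proof. by rewrite /crel glueE addNr. Qed.

Lemma crel_max : crel ord_max = 1.
Proof. by rewrite /crel glueE. Qed.

(** Differences of points of [D] live in the first [r] coordinates, and subtracting the origin from
    each [mid_pt k] yields every unit vector there, so the row space is that of [pid_mx r]. *)
Lemma affdim_cpt (r : nat) (D : {set 'I_n.+2}) : (r <= n)%N ->
  ord0 \in D -> (forall k : 'I_n, (k < r)%N -> mid_pt k \in D) ->
  (forall i (k : 'I_n), i \in D -> (r <= k)%N -> cpt i 0 k = 0) ->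
  affdim cpt D = r%:Z.
Proof.
move=> rn D0 Dk Dr; rewrite /affdim; case: pickP => [i0 Di0|/(_ ord0)]; last by rewrite D0.
set M := (X in \rank X); congr (Posz _).
have rowM i : i \in D -> (ptQ (cpt i) - ptQ (cpt i0) <= M)%MS.
  move=> Di; have -> : ptQ (cpt i) - ptQ (cpt i0) = row i M by rewrite rowK Di.
  exact: row_sub.
suff /eqmxP -> : (M == (pid_mx r : 'M[rat]_n))%MS by rewrite rank_pid_mx.
apply/andP; split; apply/row_subP => i.
  rewrite rowK; case: ifP => Di; last exact: sub0mx.
  set v := _ - _; suff -> : v = v *m pid_mx r by exact: submxMl.
  apply/rowP => k; rewrite [RHS]mxE (bigD1 k) //= big1 ?addr0 => [|l lk].
    rewrite !mxE eqxx /=; case: ltnP => kr; first by rewrite mulr1.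
    by rewrite !Dr // subrr mulr0.
  by rewrite [pid_mx _ _ _]mxE (inj_eq val_inj) (negbTE lk) mulr0.
have [ir|ri] := ltnP i r; last first.
  rewrite (_ : row i _ = 0) ?sub0mx //; apply/rowP => k.
  by rewrite !mxE ltnNge ri andbF.
rewrite (_ : row i _ = (ptQ (cpt (mid_pt i)) - ptQ (cpt i0)) - (ptQ (cpt ord0) - ptQ (cpt i0))).
  by rewrite addmx_sub ?eqmx_opp ?rowM ?Dk.
rewrite opprB addrA subrK; apply/rowP => k.
by rewrite /cpt !glueE !mxE ir andbT eqxx /= subr0 eq_sym -val_eqE; case: (_ == _).
Qed.

(** Coordinate [k0] is 0 or 1 at every point other than w, so it separates w from them. *)
Lemma cpt_inj k0 : 1 < mu k0 -> injective cpt.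
Proof.
move=> mu0; have cE i : cpt i 0 k0 = if i == ord_max then mu k0 else (i == mid_pt k0)%:Z.
  elim/pt_ind: i => [|k|]; rewrite /cpt glueE ?mxE ?eqxx //=.
  by rewrite mid_pt_eq_max (inj_eq mid_pt_inj) eq_sym natz.
have cmax i : cpt i = cpt ord_max -> i = ord_max.
  move=> /(congr1 (fun v : 'rV_n => v 0 k0)); rewrite !cE eqxx.
  by case: (i =P ord_max) => // _; case: (_ == _) => e; move: mu0; rewrite -e.
elim/pt_ind => [|k|]; elim/pt_ind => [|l|] // e; do ?[exact: cmax|exact/esym/cmax/esym].
- by move: e => /rowP /(_ l); rewrite /cpt !glueE !mxE !eqxx.
- by move: e => /rowP /(_ k); rewrite /cpt !glueE !mxE !eqxx.
- move: e => /rowP /(_ k); rewrite /cpt !glueE !mxE !eqxx /=.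
  by case: eqP => [->|].
Qed.

(** Every relation is a multiple of [crel], so a dependent set contains its whole support. That
    support is then the least dependent set. *)
Lemma aff_dep_cpt (D : {set 'I_n.+2}) :
  aff_dep cpt D <-> (forall i, crel i != 0 -> i \in D).
Proof.
split=> [[l [[i Di li] [lD [l0 lp]]]]|relD].
  have lE : forall i, l i = l ord_max * (crel i)%:~R.
    by apply: crel_unique => // k; rewrite -sum_cpt lp mxE.
  move=> i' ri'; apply: contraR li => /lD /eqP.
  by rewrite [l i']lE mulf_eq0 intr_eq0 (negbTE ri') orbF (lE i) => /eqP ->; rewrite mul0r.
exists (fun i => (crel i)%:~R); split; [|split; [|split]].
- by exists ord_max; [apply: relD|]; rewrite crel_max.
- by move=> i; apply: contraNeq; rewrite intr_eq0; apply: relD.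
- by rewrite -rmorph_sum sum_crel.
- by apply/rowP => k; rewrite sum_cpt crel_max mul1r -intrD crel_mid mxE.
Qed.

Lemma circuit_m_cpt (r : nat) : (r <= n)%N -> crel ord0 != 0 ->
  (forall k : 'I_n, (mu k != 0) = (k < r)%N) -> circuit_m cpt r.
Proof.
move=> rn r0 mur; pose D := [set i | crel i != 0].
have depD D' : aff_dep cpt D' <-> D \subset D'.
  rewrite aff_dep_cpt; split=> [h|/fintype.subsetP h i ri]; last by apply: h; rewrite inE.
  by apply/fintype.subsetP => i; rewrite inE => /h.
have minD : min_aff_dep cpt D.
  split=> [|D' ltD]; first exact/depD.
  by move=> /depD /(proper_sub_trans ltD); rewrite fintype.properxx.
exists D; split=> //; split.
  move=> D' [/depD sD min]; apply/eqP; rewrite finset.eqEsubset sD andbT.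
  by apply/negPn/negP => nsD; apply: (min D); [rewrite properE sD|apply/depD].
apply: affdim_cpt => //; first by rewrite inE.
  by move=> k kr; rewrite inE /crel glueE oppr_eq0 mur.
elim/pt_ind => [|i|] k; rewrite inE /cpt /crel !glueE ?mxE //.
  rewrite oppr_eq0 mur eqxx /= => ir rk; case: eqP => // ki.
  by move: rk; rewrite ki leqNgt ir.
by move=> _ rk; apply/eqP; rewrite -[_ == _]negbK mur -leqNgt.
Qed.

End Circuit.

(** * The normalized volume *)

Section ConvexHull.
Variables (n : nat) (mu : 'I_n -> int).
Let p := cpt mu.
Let lam := crel mu.

Definition lattice_pt (c : 'I_n.+2 -> int) (k : 'I_n) : int :=
  c (mid_pt k) + c ord_max * mu k.

(** Barycentric coefficients scaled by [K]: they exhibit [y] as a lattice point of the [K]-fold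
    dilate of the hull. *)
Definition conv_coef (K : int) (y : 'I_n -> int) (c : 'I_n.+2 -> rat) : Prop :=
  [/\ forall i, 0 <= c i, \sum_i c i = K%:~R &
      forall k, c (mid_pt k) + c ord_max * (mu k)%:~R = (y k)%:~R].

Lemma in_conv_scaled (K : nat) (y : 'I_n -> int) : (0 < K)%N ->
  in_conv p (\row_j ((y j)%:~R / K%:R)) <-> exists c, conv_coef K%:Z y c.
Proof.
move=> K0; have Kn0 : (K%:R : rat) != 0 by rewrite pnatr_eq0 -lt0n.
split=> [[l [l0 [l1 lp]]]|[c [c0 c1 cp]]].
  exists (fun i => l i * K%:R); split=> [i||k].
  - by rewrite mulr_ge0.
  - by rewrite -mulr_suml l1 mul1r.
  - have := congr1 (fun v : 'rV_n => v 0 k * K%:R) lp.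
    by rewrite sum_cpt mxE divfK // => <-; ring.
exists (fun i => c i / K%:R); split=> [i|]; first by rewrite divr_ge0.
split; first by rewrite -mulr_suml c1 divff.
by apply/rowP => k; rewrite sum_cpt mxE -cp; field.
Qed.

Lemma conv_coef_bound (K : nat) y c (B : nat) k :
  (forall i k, `|p i 0 k| <= B%:Z) -> conv_coef K%:Z y c -> `|y k| <= (B * K)%:Z.
Proof.
move=> hB [c0 c1 cp]; rewrite -(ler_int rat) intr_norm -cp -sum_cpt summxE.
apply: le_trans (ler_norm_sum _ _ _) _; rewrite PoszM intrM mulrC -c1 mulr_suml.
apply: ler_sum => i _; rewrite !mxE normrM ger0_norm // ler_wpM2l //.
by rewrite -intr_norm ler_int.
Qed.

(* Sliding along the affine relation makes all coefficients nonnegative with some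
   [c j = 0], [lam j > 0]; rounding that shift to an integer leaves [c j = e]. *)
Lemma cell_cover (K : int) y c : conv_coef K y c ->
  exists j (e : int) (c' : 'I_n.+2 -> int), [/\ 0 <= e < lam j, c' j = e, forall i, - `|lam i| <= c' i,
    \sum_i c' i = K & forall k, lattice_pt c' k = y k].
Proof.
(* [d] represents [y] by integers with weight 0 at w; [c] differs from it by a multiple of [lam]. *)
move=> [c0 c1 cp]; pose d : 'I_n.+2 -> int := glue (K - \sum_k y k) y 0.
have dmax : d ord_max = 0 by rewrite /d glueE.
have sumd : \sum_i d i = K.
  rewrite sum_pt (eq_bigr y) => [|k _]; last by rewrite /d glueE.
  by rewrite /d !glueE; ring.
have cE i : c i - (d i)%:~R = c ord_max * (lam i)%:~R.
  have /= := @crel_unique n mu rat (fun i => c i - (d i)%:~R).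
  rewrite dmax subr0 => -> //; first by rewrite sumrB c1 -rmorph_sum sumd subrr.
  by move=> k; rewrite addrAC cp /d glueE subrr.
have lmax : 0 < lam ord_max by rewrite /lam crel_max.
case: (@arg_minP _ _ _ ord_max (fun i => 0 < lam i) (fun i => c i / (lam i)%:~R) lmax).
move=> j lj minj; pose q := (d j %/ lam j)%Z; pose e := (d j %% lam j)%Z.
have dj : d j = q * lam j + e := divz_eq _ _.
have e0 : 0 <= e by rewrite modz_ge0 // gt_eqF.
have el : e < lam j by rewrite ltz_pmod.
exists j, e, (fun i => d i - q * lam i); split.
- by rewrite e0 el.
- by rewrite dj; ring.
- move=> i; rewrite -(ler_int rat) rmorphN /= intr_norm rmorphB rmorphM /=.
  have dE := cE i; have djE := cE j; rewrite dj rmorphD rmorphM /= in djE.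
  have lj' : 0 < (lam j)%:~R :> rat by rewrite ltr0z.
  have e0' : 0 <= e%:~R :> rat by rewrite ler0z.
  have el' : e%:~R < (lam j)%:~R :> rat by rewrite ltr_int.
  set r := c j / (lam j)%:~R.
  set u := e%:~R / (lam j)%:~R : rat.
  have r0 : 0 <= r by rewrite divr_ge0 // ltW.
  have u0 : 0 <= u by rewrite divr_ge0 // ltW.
  have u1 : u <= 1 by rewrite ler_pdivrMr // mul1r ltW.
  have sq : c ord_max = r - q%:~R - u.
    rewrite /r /u; apply: (mulIf (lt0r_neq0 lj')); rewrite -djE; field.
    exact: lt0r_neq0.
  (* After the full slide by [r] the coefficient is nonnegative; rounding adds [u * lam i] with [u]
     in [0, 1], which costs at most [|lam i|]. *)
  have -> : (d i)%:~R - q%:~R * (lam i)%:~R = c i - (lam i)%:~R * r + (lam i)%:~R * u.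
    by rewrite sq in dE; lra.
  have ci := c0 i; have [li|li] := ltP 0 (lam i).
    have li' : 0 < (lam i)%:~R :> rat by rewrite ltr0z.
    have := minj _ li; rewrite -/r ler_pdivlMr // gtr0_norm // => h; nra.
  have li' : (lam i)%:~R <= 0 :> rat by rewrite lerz0.
  by rewrite ler0_norm //; nra.
- by rewrite sumrB sumd -mulr_sumr sum_crel mulr0 subr0.
- move=> k; rewrite /lattice_pt dmax /lam crel_max /d glueE.
  by rewrite -(addr0_eq (crel_mid mu k)); ring.
Qed.

(** A partial converse of the covering: sliding by [u = e / lam j], in [0, 1], empties the
    coefficient at [j] and lowers any other by at most [|lam i|]. *)
Lemma cell_conv (K : int) j (e : int) c : 0 <= e < lam j -> c j = e ->
  (forall i, i != j -> `|lam i| <= c i) -> \sum_i c i = K ->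
  exists c', conv_coef K (lattice_pt c) c'.
Proof.
move=> /andP[e0 el] cj ci cK; have lj : 0 < lam j by apply: le_lt_trans el.
have lj' : 0 < (lam j)%:~R :> rat by rewrite ltr0z.
pose u := e%:~R / (lam j)%:~R : rat.
have u0 : 0 <= u by rewrite divr_ge0 ?ler0z // ltW.
have u1 : u <= 1 by rewrite ler_pdivrMr // mul1r ler_int ltW.
exists (fun i => (c i)%:~R - u * (lam i)%:~R); split.
- move=> i; have [->|ij] := eqVneq i j; first by rewrite cj divfK ?subrr ?gt_eqF.
  have := ci i ij; rewrite -(ler_int rat) intr_norm => h.
  by have := ler_norm ((lam i)%:~R : rat); have := normr_ge0 ((lam i)%:~R : rat); nra.
- by rewrite sumrB -rmorph_sum cK -mulr_sumr -rmorph_sum sum_crel mulr0 subr0.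
- move=> k; rewrite /lattice_pt rmorphD rmorphM /lam /= crel_max.
  by rewrite -(addr0_eq (crel_mid mu k)) rmorphN /=; ring.
Qed.

(** Two integral representations of one point differ by [q * lam]. If [j] and [j'] were distinct,
    comparing at [j] would give [q > 0] and at [j'] would give [q < 0]. If they agree, [e' - e] is a
    multiple of [lam j] smaller than [lam j] in size, so [q = 0]. *)
Lemma cell_disjoint (L : int) j e c j' e' c' :
  (forall i, lam i <= L) -> e < lam j -> 0 <= e -> e' < lam j' -> 0 <= e' ->
  c j = e -> c' j' = e' ->
  (forall i, i != j -> L < c i) -> (forall i, i != j' -> L < c' i) ->
  \sum_i c i = \sum_i c' i -> lattice_pt c =1 lattice_pt c' ->
  [/\ j = j', e = e' & c =1 c'].
Proof.
move=> lL el e0 el' e0' cj cj' ci ci' sumE latE.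
have cE i : c' i - c i = (c' ord_max - c ord_max) * lam i.
  have /= -> // := @crel_unique n mu int (fun i => c' i - c i); rewrite ?intz //.
    by rewrite sumrB sumE subrr.
  by move=> k; have := latE k; rewrite /lattice_pt intz; lia.
set q := c' ord_max - c ord_max in cE.
have jj : j = j'.
  apply/eqP; apply: contraT => jj; have := ci' j jj; rewrite eq_sym in jj.
  have := ci j' jj; have := cE j; have := cE j'; have := lL j; have := lL j'.
  rewrite cj cj' => *; nia.
rewrite -jj in cj' el' *; have q0 : q = 0 by have := cE j; rewrite cj cj'; nia.
have ccE : c =1 c' by move=> i; have := cE i; rewrite q0; lia.
by split=> //; rewrite -cj ccE.
Qed.

End ConvexHull.

Lemma leq_card_bigcup (I T : finType) (F : I -> {set T}) :
  (#|\bigcup_i F i| <= \sum_i #|F i|)%N.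
Proof.
apply: (big_ind2 (fun (A : {set T}) k => #|A| <= k)%N) => [|A k B l Ak Bl|//].
  by rewrite cards0.
by apply: leq_trans (leq_add Ak Bl); rewrite cardsU leq_subr.
Qed.

Lemma card_disjoint_bigcup (I T : finType) (F : I -> {set T}) :
  (forall i j, i != j -> [disjoint F i & F j]) ->
  #|\bigcup_i F i| = (\sum_i #|F i|)%N.
Proof.
move=> disjF; rewrite -sum1_card partition_disjoint_bigcup //.
by apply: eq_bigr => i _; rewrite sum1_card.
Qed.

Lemma le_coord_bound (n k : nat) (p : 'I_k -> 'rV[int]_n) i j :
  `|p i 0 j| <= (coord_bound p)%:Z.
Proof.
rewrite -abszE lez_nat; apply: leq_trans (leq_bigmax i).
by rewrite (leq_bigmax (F := fun j => absz (p i ord0 j))).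
Qed.

(** * Counting lattice points in dilates of the convex hull *)

Section GridCount.
Variables (n : nat) (mu : 'I_n -> int) (L : nat).
Let p := cpt mu.
Let lam := crel mu.
Let B := coord_bound p.
Hypothesis lamL : forall i, `|lam i| <= L%:Z.

(* A pair [(j, e)] stands for the lattice points whose integer coefficients can be
   normalized to [e] at [j], i.e. for a residue class in the simplex omitting [j]. *)
Definition cell : finType := {a : 'I_n.+2 * 'I_L.+1 | a.2%:Z < crel mu a.1}.

(** The offset [b] makes the entries of [t] natural numbers: it is [- L] for the upper bound, where
    cells only need to cover, and [L + 1] for the lower bound, where they must be disjoint and
    inside the hull. *)
Definition cell_coef (a : cell) (b : int) (S : nat) (t : n.+1.-tuple 'I_S.+1)
    (i : 'I_n.+2) : int :=
  if unlift (val a).1 i is Some i' then (tnth t i')%:Z + b else (val a).2%:Z.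

(** The shift by [B * K] turns coordinates into ordinals; for points of the dilated hull [inord]
    loses nothing. *)
Definition grid_pt (K : nat) (a : cell) (b : int) (S : nat)
    (t : n.+1.-tuple 'I_S.+1) : {ffun 'I_n -> 'I_(2 * B * K).+1} :=
  [ffun k => inord (absz (lattice_pt mu (cell_coef a b t) k + (B * K)%:Z))].

Definition compositions (S : nat) : {set n.+1.-tuple 'I_S.+1} :=
  [set t : n.+1.-tuple 'I_S.+1 | \sum_(i <- t) i == S]%N.

Definition grid (K : nat) : {set {ffun 'I_n -> 'I_(2 * B * K).+1}} :=
  [set f : {ffun 'I_n -> 'I_(2 * B * K).+1} |
    `[< in_conv p (\row_j (((f j)%:Z - (B * K)%:Z)%:~R / K%:R)) >] ].

Lemma mem_grid K f : (0 < K)%N ->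
  f \in grid K <-> exists c, conv_coef mu K%:Z (fun k => (f k)%:Z - (B * K)%:Z) c.
Proof. by move=> K0; rewrite inE -in_conv_scaled //; split=> /asboolP. Qed.

Lemma cell_coef_self a b S (t : n.+1.-tuple 'I_S.+1) :
  cell_coef a b t (val a).1 = (val a).2%:Z.
Proof. by rewrite /cell_coef unlift_none. Qed.

Lemma cell_coef_lift a b S (t : n.+1.-tuple 'I_S.+1) i :
  cell_coef a b t (lift (val a).1 i) = (tnth t i)%:Z + b.
Proof. by rewrite /cell_coef liftK. Qed.

Lemma sum_cell_coef a b S (t : n.+1.-tuple 'I_S.+1) : t \in compositions S ->
  \sum_i cell_coef a b t i = (val a).2%:Z + S%:Z + b * n.+1%:Z.
Proof.
rewrite inE big_tuple => /eqP tS; rewrite (bigD1_ord (val a).1) //= cell_coef_self.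
rewrite (eq_bigr (fun i => (tnth t i)%:Z + b)) => [|i _]; last by rewrite cell_coef_lift.
rewrite big_split /= sumr_const card_ord -addrA; congr (_ + (_ + _)).
  by rewrite -[in RHS]tS; elim/big_rec2: _ => // i x y _ ->; rewrite PoszD.
by rewrite -mulr_natr natz.
Qed.

(** By [cell_cover] each grid point comes from a cell and a composition. Outside [j] the
    coefficients sum to [K - e], and raising each of the [n + 1] by [L] gives the total [S]. *)
Lemma card_grid_le K : (0 < K)%N ->
  (#|grid K| <= #|{: cell}| * 'C(n + (K + n.+1 * L), n))%N.
Proof.
move=> K0; pose S (a : cell) := (K + n.+1 * L - (val a).2)%N.
have sub : grid K \subset
    \bigcup_(a : cell) (@grid_pt K a (- L%:Z) (S a) @: compositions (S a)).
  apply/fintype.subsetP => f /(mem_grid _ K0)[c /cell_cover[j [e [c' []]]]].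
  move=> /andP[e0 el] cj cL cK cy.
  have eL : (`|e| < L.+1)%N by have := lamL j; rewrite /lam; lia.
  have aP : (inord `|e| : 'I_L.+1)%:Z < crel mu j by rewrite inordK // gez0_abs.
  pose a : cell := Sub (j, inord `|e|%N) aP.
  have aE : (val a).2%:Z = e by rewrite /= inordK // gez0_abs.
  have cl i : 0 <= c' (lift j i) + L%:Z.
    by have := cL (lift j i); have := lamL (lift j i); rewrite /lam; lia.
  have sumS : (\sum_(i < n.+1) absz (c' (lift j i) + L%:Z)%R = S a)%N.
    apply/eqP; rewrite -eqz_nat; apply/eqP.
    have -> : (S a)%:Z = K%:Z + (n.+1 * L)%:Z - e by rewrite /S -aE; have := ltn_ord (val a).2; lia.
    rewrite -cK (bigD1_ord j) //= cj.
    rewrite (eq_bigr (fun i => `|c' (lift j i) + L%:Z|%:Z - L%:Z)) => [|i _]; last first.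
      by rewrite gez0_abs // addrK.
    rewrite big_split /= sumr_const card_ord -mulr_natl natz.
    rewrite (_ : \sum_(i < n.+1) _ = Posz (\sum_(i < n.+1) absz (c' (lift j i) + L%:Z)%R)%N).
      by rewrite PoszM; ring.
    by elim/big_rec2: _ => // i x y _ ->; rewrite PoszD.
  have ltS i : (absz (c' (lift j i) + L%:Z)%R < (S a).+1)%N.
    by rewrite ltnS -sumS (bigD1 i) //= leq_addr.
  pose t : n.+1.-tuple 'I_(S a).+1 := [tuple inord (absz (c' (lift j i) + L%:Z)) | i < n.+1].
  apply/finset.bigcupP; exists a => //; apply/imsetP.
  exists t.
    rewrite inE big_tuple -[X in _ == X]sumS; apply/eqP/eq_bigr => i _.
    by rewrite tnth_mktuple inordK.
  apply/ffunP => k; rewrite ffunE; apply/val_inj.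
  have -> : lattice_pt mu (cell_coef a (- L%:Z) t) k = lattice_pt mu c' k.
    have cE i : cell_coef a (- L%:Z) t i = c' i.
      have [i' ->|->] := unliftP j i; last by rewrite (cell_coef_self a) aE cj.
      by rewrite (cell_coef_lift a) tnth_mktuple inordK // gez0_abs // addrK.
    by rewrite /lattice_pt !cE.
  by rewrite cy subrK absz_nat inord_val.
apply: leq_trans (subset_leq_card sub) _; apply: leq_trans (leq_card_bigcup _) _.
rewrite -sum_nat_const; apply: leq_sum => a _; apply: leq_trans (leq_imset_card _ _) _.
by rewrite /compositions card_ord_partitions leq_bin2l // leq_add2l leq_subr.
Qed.

(** With offset [L + 1], [cell_conv] puts every cell point in the grid and [cell_disjoint] makes all
    these points distinct. *)
Lemma card_grid_ge K : (n.+2 * L.+1 <= K)%N ->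
  (#|{: cell}| * 'C(n + (K - n.+2 * L.+1), n) <= #|grid K|)%N.
Proof.
move=> KL; have K0 : (0 < K)%N by apply: leq_trans KL.
pose S (a : cell) := (K - (val a).2 - n.+1 * L.+1)%N.
pose phi a := @grid_pt K a (L.+1)%:Z (S a).
(* As [e <= L], the lower bound on [K] keeps the subtractions in [S] from truncating. *)
have SE (a : cell) : (val a).2%:Z + (S a)%:Z + L.+1%:Z * n.+1%:Z = K%:Z.
  by rewrite /S; have := ltn_ord (val a).2; nia.
have coefL (a : cell) (t : n.+1.-tuple 'I_(S a).+1) i :
    i != (val a).1 -> L%:Z < cell_coef a L.+1%:Z t i.
  have [i' ->|->] := unliftP (val a).1 i; last by rewrite eqxx.
  by rewrite cell_coef_lift; lia.
have e0 (a : cell) : 0 <= (val a).2%:Z by [].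
have conv (a : cell) t : t \in compositions (S a) ->
    exists c, conv_coef mu K%:Z (lattice_pt mu (cell_coef a L.+1%:Z t)) c.
  move=> tS; apply: (@cell_conv _ _ _ (val a).1 (val a).2%:Z).
  - by rewrite (valP a).
  - exact: cell_coef_self.
  - by move=> i /coefL h; apply: le_trans (lamL i) (ltW (h _)).
  - by rewrite sum_cell_coef // SE.
have phiE (a : cell) t k : t \in compositions (S a) ->
    (phi a t k)%:Z - (B * K)%:Z = lattice_pt mu (cell_coef a L.+1%:Z t) k.
  move=> /conv[c cc]; have := conv_coef_bound k (@le_coord_bound _ _ p) cc.
  rewrite /phi ffunE -/B; set y := lattice_pt _ _ _ => yB.
  by rewrite inordK ?gez0_abs; nia.
have phi_inj (a a' : cell) t t' : t \in compositions (S a) -> t' \in compositions (S a') ->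
    phi a t = phi a' t' ->
    a = a' /\ cell_coef a L.+1%:Z t =1 cell_coef a' L.+1%:Z t'.
  move=> tS tS' e.
  have [|||||||||||j12 e12 cE] := @cell_disjoint _ mu L%:Z (val a).1 (val a).2%:Z
    (cell_coef a L.+1%:Z t) (val a').1 (val a').2%:Z (cell_coef a' L.+1%:Z t').
  - by move=> i; apply: le_trans (ler_norm _) (lamL i).
  - exact: valP a.
  - by [].
  - exact: valP a'.
  - by [].
  - exact: cell_coef_self.
  - exact: cell_coef_self.
  - exact: coefL.
  - exact: coefL.
  - by rewrite !sum_cell_coef // !SE.
  - by move=> k; rewrite -!phiE // e.
  split=> //; apply: val_inj; case: (val a) (val a') j12 e12 => [j u] [j' u'] /= -> [uu].
  by congr (_, _); apply: val_inj.
have sub : \bigcup_(a : cell) (phi a @: compositions (S a)) \subset grid K.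
  apply/fintype.subsetP => f /finset.bigcupP[a _ /imsetP[t tS ->]].
  apply/mem_grid => //; have [c [c0 c1 cp]] := conv a t tS.
  by exists c; split=> // k; rewrite cp phiE.
apply: leq_trans (subset_leq_card sub); rewrite card_disjoint_bigcup => [|a a' aa']; last first.
  apply/pred0P => f /=; apply/negP => /andP[/imsetP[t tS ->] /imsetP[t' tS' e]].
  by have [/eqP] := phi_inj _ _ _ _ tS tS' e; rewrite (negbTE aa').
rewrite -sum_nat_const; apply: leq_sum => a _; rewrite card_in_imset.
  rewrite /compositions card_ord_partitions leq_bin2l // leq_add2l /S.
  by have := ltn_ord (val a).2; nia.
move=> t t' tS tS' /(phi_inj _ _ _ _ tS tS')[_ cE]; apply/eq_from_tnth => i.
by apply/val_inj; have := cE (lift (val a).1 i); rewrite !cell_coef_lift => /addIr [].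
Qed.

End GridCount.

(** * Passage from lattice point counts to the volume *)

Lemma ffact_bounds (n s : nat) : (s ^ n <= (n + s) ^_ n <= (n + s) ^ n)%N.
Proof.
rewrite ffact_prod -[X in (_ ^ X <= _)%N](card_ord n) -[X in (_ <= _ ^ X)%N](card_ord n).
rewrite -!prod_nat_const; apply/andP; split; apply: leq_prod => i _; last exact: leq_subr.
by have := ltn_ord i; lia.
Qed.

Lemma cvg_harmonic_exp (R : realType) (v a : R) (n : nat) :
  ((fun K : nat => v * (1 + a * harmonic K) ^+ n) @ \oo --> v)%classic.
Proof.
have h : ((fun K : nat => 1 + a * harmonic K : R) @ \oo --> (1 : R))%classic.
  rewrite -[X in (_ --> X)%classic]addr0 -[X in _ + X](mulr0 a).
  by apply: cvgD; [exact: cvg_cst|apply: cvgM; [exact: cvg_cst|exact: cvg_harmonic]].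
rewrite -[X in (_ --> X)%classic]mulr1 -[X in _ * X](expr1n _ n).
apply: cvgM; first exact: cvg_cst.
exact: (continuous_cvg _ (@exprn_continuous R n 1) h).
Qed.

Lemma normalized_volume_cpt (R : realType) (n : nat) (mu : 'I_n -> int) (L : nat) :
  (0 < n)%N -> (forall i, `|crel mu i| <= L%:Z) ->
  normalized_volume R (cpt mu) = #|{: cell mu L}|%:R.
Proof.
(* [A] dominates the shifts in both counting bounds, so [n!] times the count lies between
   [v * (K.+1 - A) ^ n] and [v * (K.+1 + A) ^ n]. *)
move=> n0 lamL; set v := #|_|; pose A := (n.+2 * L.+1 + n)%N.
apply: cvg_lim => //.
apply: squeeze_cvgr (@cvg_harmonic_exp R v%:R (- A%:R) n) (@cvg_harmonic_exp R v%:R A%:R n).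
exists A => // K /= AK.
have K0 : 0 < (K.+1%:R : R) by rewrite ltr0n.
have fK (x : R) : 1 + x * harmonic K = (K.+1%:R + x) / K.+1%:R.
  by rewrite /harmonic /= mulrDl divff ?gt_eqF.
rewrite !fK !expr_div_n !mulrA !ler_pM2r ?invr_gt0 ?exprn_gt0 //.
have AK' : (A <= K.+1)%N by rewrite ltnW.
rewrite -natrB // -natrD -!natrX -!natrM !ler_nat.
have gE : grid_count (cpt mu) K.+1 = #|grid mu K.+1|.
  by apply: eq_card => f; rewrite [RHS]inE; apply/idP/idP => [/set_mem|/mem_set].
rewrite gE; apply/andP; split.
  apply: (@leq_trans (n`! * (v * 'C(n + (K.+1 - n.+2 * L.+1), n)))); last first.
    by rewrite leq_mul2l card_grid_ge ?orbT //; rewrite /A in AK'; lia.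
  rewrite mulnCA leq_mul2l [X in _ || (_ <= X)%N]mulnC bin_ffact.
  have /andP[h _] := ffact_bounds n (K.+1 - n.+2 * L.+1).
  by rewrite (leq_trans _ h) ?orbT // leq_exp2r // leq_sub2l // leq_addr.
apply: (@leq_trans (n`! * (v * 'C(n + (K.+1 + n.+1 * L), n)))).
  by rewrite leq_mul2l card_grid_le ?orbT.
rewrite mulnCA leq_mul2l [X in _ || (X <= _)%N]mulnC bin_ffact.
have /andP[_ h] := ffact_bounds n (K.+1 + n.+1 * L).
apply/orP; right; apply: leq_trans h _; rewrite leq_exp2r // /A; nia.
Qed.

(** * The univariate equation *)

Section ContinuedFraction.

(* With [l i := 1 + d i * 'X], [(cfrac d m).1 / (cfrac d m).2] is
   ['X * l 1 ^ 2 * l 3 ^ 2 * ... / (l 0 ^ 2 * l 2 ^ 2 * ...)] (indices below [m]),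
   inverted when [m] is odd so that the numerator always has the larger degree. *)
Fixpoint cfrac (R : nzRingType) (d : nat -> R) (m : nat) : {poly R} * {poly R} :=
  if m is m'.+1 then
    ((cfrac d m').2 * (1 + d m' *: 'X) ^+ 2, (cfrac d m').1)
  else ('X, 1).

Definition cfrac_diff (R : nzRingType) (d : nat -> R) m : {poly R} :=
  (cfrac d m).1 - (cfrac d m).2.

Lemma eq_cfrac (R : nzRingType) (d d' : nat -> R) m :
  (forall i, (i < m)%N -> d i = d' i) -> cfrac d m = cfrac d' m.
Proof.
elim: m => //= m IHm dd'; rewrite IHm => [|i im]; first by rewrite dd'.
exact/dd'/ltnW.
Qed.

Variable R : rcfType.
Implicit Types (d : nat -> R) (m : nat).

Lemma size_lead_linear (a : R) : 0 < a ->
  size (1 + a *: 'X) = 2%N /\ lead_coef (1 + a *: 'X) = a.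
Proof.
move=> a0; have sX : size (a *: 'X : {poly R}) = 2%N by rewrite size_scale ?gt_eqF // size_polyX.
by rewrite addrC size_polyDl ?lead_coefDl ?sX ?size_poly1 // lead_coefZ lead_coefX mulr1.
Qed.

Lemma horner_linear (a x : R) : (1 + a *: 'X).[x] = 1 + a * x.
Proof. by rewrite !hornerE. Qed.

Lemma cfrac_size_lead d m : (forall i, 0 < d i) ->
  [/\ size (cfrac d m).1 = m.+2, size (cfrac d m).2 = m.+1,
      0 < lead_coef (cfrac d m).1 & 0 < lead_coef (cfrac d m).2].
Proof.
move=> d0; elim: m => [|m [sU sV lU lV]] /=.
  by rewrite size_polyX size_poly1 lead_coefX lead_coef1 ltr01.
have [sl ll] := size_lead_linear (d0 m).
have l0 : 1 + d m *: 'X != 0 :> {poly R} by rewrite -size_poly_eq0 sl.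
have V0 : (cfrac d m).2 != 0 by rewrite -size_poly_eq0 sV.
split=> //; last by rewrite lead_coefM lead_coef_exp ll mulr_gt0 // exprn_gt0.
by rewrite expr2 !size_mul ?mulf_neq0 // sV sl; lia.
Qed.

Lemma cfrac_gt0 d m x : (forall i, 0 < d i) -> 0 < x ->
  0 < (cfrac d m).1.[x] /\ 0 < (cfrac d m).2.[x].
Proof.
move=> d0 x0; elim: m => [|m [U0 V0]] /=; first by rewrite !hornerE.
split=> //; rewrite hornerM horner_exp horner_linear mulr_gt0 // exprn_gt0 //.
by rewrite addr_gt0 // mulr_gt0.
Qed.

Lemma cfrac_diff_size_lead d m : (forall i, 0 < d i) ->
  size (cfrac_diff d m) = m.+2 /\ 0 < lead_coef (cfrac_diff d m).
Proof.
move=> /(@cfrac_size_lead d m)[sU sV lU lV].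
by rewrite /cfrac_diff size_polyDl ?lead_coefDl ?size_polyN ?sU ?sV.
Qed.

Lemma small_sqr_perturbation (u v t : R) : 0 < v -> v < u -> 0 < t ->
  exists2 a, 0 < a & forall e, 0 < e <= a -> v * (1 + e * t) ^+ 2 < u.
Proof.
(* For [e <= 1] the perturbed value is at most [v + e * w], and the threshold makes [e * w] at most
   half of the gap [u - v]. *)
move=> v0 vu t0; pose w := v * (2 * t + t ^+ 2).
have w0 : 0 < w by rewrite /w mulr_gt0 // addr_gt0 ?mulr_gt0 ?exprn_gt0.
have w2 : 0 < 2 * w by rewrite mulr_gt0.
exists (Num.min 1 ((u - v) / (2 * w))).
  by rewrite lt_min ltr01 divr_gt0 ?subr_gt0.
move=> e /andP[e0]; rewrite le_min => /andP[e1]; rewrite ler_pdivlMr // => ew.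
have h : v * (1 + e * t) ^+ 2 <= v + e * w.
  have -> : v + e * w = v * (1 + e * t) ^+ 2 + v * t ^+ 2 * (e * (1 - e)) by rewrite /w; ring.
  by rewrite lerDl !mulr_ge0 ?exprn_ge0 ?subr_ge0 // ltW.
by apply: le_lt_trans h _; lra.
Qed.

Lemma uniform_small (P : nat -> R -> Prop) (N : nat) :
  (forall i, (i < N)%N -> exists2 a, 0 < a & forall e, 0 < e <= a -> P i e) ->
  exists2 a, 0 < a & forall i, (i < N)%N -> P i a.
Proof.
move=> hP; suff [a a0 ha] : exists2 a, 0 < a & forall i, (i < N)%N -> forall e, 0 < e <= a -> P i e.
  by exists a => // i iN; apply: ha; rewrite ?a0 /=.
elim: N hP => [|N IHN] hP; first by exists 1.
have [a a0 ha] := IHN (fun i iN => hP i (ltnW iN)); have [b b0 hb] := hP N (ltnSn N).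
exists (Num.min a b); first by rewrite lt_min a0.
move=> i; rewrite ltnS leq_eqVlt => iN e /andP[e0]; rewrite le_min => /andP[ea eb].
by case/orP: iN => [/eqP->|iN]; [apply: hb|apply: ha]; rewrite ?e0.
Qed.

(** Induction on [m]: passing to [m + 1] swaps numerator and denominator, which flips all signs at
    the old points, and a small new [d m] preserves this; the new last point is taken where the
    positive leading term dominates. *)
Lemma cfrac_alternation m : exists d (t : nat -> R),
  [/\ forall i, 0 < d i, 0 < t 0%N, forall i, (i <= m)%N -> t i < t i.+1 &
      forall i, (i <= m.+1)%N -> 0 < (-1) ^+ (i + m.+1) * (cfrac_diff d m).[t i]].
Proof.
elim: m => [|m [d [t [d0 t0 tS sg]]]].
  (* For [m = 0] the polynomial is ['X - 1], tested at 1/2 and 3/2. *)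
  exists (fun=> 1), (fun i => (2%:R ^- 1) + i%:R); split=> //.
  - by rewrite addr0 invr_gt0.
  - by move=> i _; rewrite ltrD2l ltr_nat.
  - move=> [|[|//]] _; rewrite /cfrac_diff /= !hornerE; lra.
have tpos i : (i <= m.+1)%N -> 0 < t i.
  by elim: i => // i IHi im; apply: lt_trans (tS i im); apply: IHi; apply: ltnW.
pose P i e := 0 < (-1) ^+ (i + m.+2) *
  ((cfrac d m).2.[t i] * (1 + e * t i) ^+ 2 - (cfrac d m).1.[t i]).
have [|a a0 ha] := @uniform_small P m.+2.
  rewrite /P => i im; have ti := tpos i im; have [U0 V0] := cfrac_gt0 m d0 ti.
  rewrite [(i + m.+2)%N]addnS; have := sg i im; rewrite /cfrac_diff !hornerE exprS.
  (* Where the old difference is negative, a factor at least 1 only helps; where it is positive, the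
     factor must be close to 1. *)
  rewrite -signr_odd; case: (odd _); rewrite ?expr1 ?expr0.
    move=> UV; exists 1 => // e /andP[e0 _].
    have h : 1 <= (1 + e * t i) ^+ 2.
      by rewrite exprn_ege1 // lerDl mulr_ge0 // ltW.
    by move: UV; rewrite mulrNN !mul1r; nra.
  rewrite mul1r subr_gt0 => UV.
  have [a a0 ha] := small_sqr_perturbation V0 UV ti.
  by exists a => // e /ha; rewrite mulr1 mulN1r opprB subr_gt0.
pose d' i := if i == m then a else d i.
have d'0 i : 0 < d' i by rewrite /d'; case: ifP.
have UVE : cfrac d' m = cfrac d m.
  by apply: eq_cfrac => i im; rewrite /d' ltn_eqF.
have [_ lc] := cfrac_diff_size_lead m.+1 d'0.
have [b hb] := poly_pinfty_gt_lc lc.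
pose t' i := if i == m.+2 then Num.max b (t m.+1 + 1) else t i.
have t'E i : (i <= m.+1)%N -> t' i = t i by move=> im; rewrite /t' ltn_eqF.
exists d', t'; split=> //.
- move=> i; rewrite leq_eqVlt => /orP[/eqP ->|im].
    by rewrite t'E // /t' eqxx lt_max ltrDl ltr01 orbT.
  by rewrite !t'E // 1?ltnW // tS.
- move=> i; rewrite leq_eqVlt => /orP[/eqP ->|im].
    rewrite -signr_odd addnn odd_double mul1r /t' eqxx.
    by apply: lt_le_trans lc (hb _ _); rewrite le_max lexx.
  by rewrite t'E // /cfrac_diff /= UVE /d' eqxx hornerD hornerN hornerM horner_exp horner_linear; apply: ha.
Qed.

(** The intermediate value theorem gives one root in each of the [m + 1] consecutive intervals. *)
Lemma cfrac_diff_roots m : exists d (rs : seq R),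
  [/\ forall i, 0 < d i, size rs = m.+1, uniq rs,
      forall r, r \in rs -> 0 < r & all (root (cfrac_diff d m)) rs].
Proof.
have [d [t [d0 t0 tS sg]]] := cfrac_alternation m; set f := cfrac_diff d m in sg *.
have [i|r rP] := choice (Y := R) (P := fun (i : nat) (x : R) => (i <= m)%N -> [/\ t i < x, x < t i.+1 & root f x]).
  case: (leqP i m) => im; last by exists 0.
  have /(poly_ivtoo (ltW (tS i im)))[x] : f.[t i] * f.[t i.+1] < 0.
    have := sg i.+1 im; have := sg i (leq_trans im (leqnSn _)).
    by rewrite addSn exprS -signr_odd; case: (odd _); rewrite ?expr1 ?expr0; nra.
  by rewrite in_itv => /andP[tx xt] fx; exists x.
have tmono i j : (i <= j)%N -> (j <= m.+1)%N -> t i <= t j.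
  move=> ij; rewrite -(subnK ij); elim: (j - i)%N => // k IHk km.
  by apply: le_trans (IHk (ltnW km)) (ltW (tS _ km)).
have rmono i j : (i < j)%N -> (j <= m)%N -> r i < r j.
  move=> ij jm; have [_ i2 _] := rP i (leq_trans (ltnW ij) jm).
  have [j1 _ _] := rP j jm; apply: lt_trans j1; apply: lt_le_trans i2 _.
  by apply: tmono => //; apply: leq_trans jm _.
exists d, [seq r i | i <- iota 0 m.+1]; split=> //.
- by rewrite size_map size_iota.
- rewrite map_inj_in_uniq ?iota_uniq // => i j; rewrite !mem_iota /= !add0n !ltnS => im jm.
  have [ij|ij|//] := ltngtP i j => e.
    by have := rmono _ _ ij jm; rewrite e ltxx.
  by have := rmono _ _ ij im; rewrite e ltxx.
- move=> x; case/mapP => i; rewrite mem_iota add0n ltnS /= => im ->.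
  have [i1 _ _] := rP i im; apply: lt_trans i1; apply: lt_le_trans t0 _.
  by apply: tmono => //; apply: leq_trans im _.
- by apply/allP => x; case/mapP => i; rewrite mem_iota add0n ltnS /= => im ->; have [] := rP i im.
Qed.

End ContinuedFraction.

(** * The system *)

Definition alt_exp (m k : nat) : int := if (k < m)%N then (if odd k then -2 else 2) else 0.

Lemma big_ord_ltn (T : Type) (idx : T) (op : Monoid.law idx) (n m : nat) (F : nat -> T) :
  (m <= n)%N -> \big[op/idx]_(k < n) (if (k < m)%N then F k else idx) = \big[op/idx]_(k < m) F k.
Proof. by move=> mn; rewrite -big_mkcond (big_ord_widen n F mn). Qed.

Section AlternatingCircuit.
Variables (n m : nat).
Hypothesis mn : (m <= n)%N.
Let mu (k : 'I_n) := alt_exp m k.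

Lemma sum_alt_exp : \sum_k mu k = if odd m then 2 else 0.
Proof.
rewrite /mu /alt_exp (big_ord_ltn _ (fun k => if odd k then -2 else 2)) //.
elim: m => [|l IHl]; first by rewrite big_ord0.
by rewrite big_ord_recr IHl /=; case: (odd l).
Qed.

(** Alternating signs make this nonzero for either parity, so the origin lies in the minimal
    dependent subset. *)
Lemma crel_alt0 : crel mu ord0 = if odd m then 1 else -1.
Proof. by rewrite /crel glueE sum_alt_exp; case: ifP. Qed.

Lemma crel_alt_mid k : crel mu (mid_pt k) = - mu k.
Proof. by rewrite /crel glueE. Qed.

Lemma crel_alt_le i : `|crel mu i| <= 2.
Proof.
elim/pt_ind: i => [|k|]; rewrite ?crel_alt0 ?crel_alt_mid ?crel_max //.
  by case: ifP.
by rewrite normrN /mu /alt_exp; do 2?case: ifP.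
Qed.

Lemma card_cell_alt : #|{: cell mu 2}| = m.+1.
Proof.
(* For [z <= 2], [cnt z] is the positive part of [z]; the positive coefficients sit at w, at $e_k$
   with [k] odd, and at the origin when [m] is odd. *)
pose cnt (z : int) := (\sum_(e < 3 | (e%:Z < z)%R) 1)%N.
have cntE (z : int) : cnt z = ((0 < z)%R + ((1 < z)%R + (2 < z)%R))%N.
  by rewrite /cnt big_mkcond !big_ord_recl big_ord0 /= addn0; do 3!case: (_ < z).
transitivity (\sum_j cnt (crel mu j))%N.
  by rewrite card_sig -sum1_card pair_big_dep /=; apply: eq_bigl => a; rewrite inE.
rewrite sum_pt crel_alt0 crel_max.
rewrite (eq_bigr (fun k : 'I_n => if (k < m)%N then (odd k).*2 else 0%N)) => [|k _].
  rewrite (big_ord_ltn _ (fun k => (odd k).*2)) // !cntE /=.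
  have -> : (\sum_(k < m) (odd k).*2 = (m./2).*2)%N.
    elim: m => [|l IHl]; first by rewrite big_ord0.
    by rewrite big_ord_recr IHl /= uphalf_half doubleD addnC.
  by rewrite -[in RHS](odd_double_half m); case: (odd m) => /=; lia.
by rewrite crel_alt_mid cntE /mu /alt_exp; case: ifP => _ //; case: (odd k).
Qed.

End AlternatingCircuit.

Section CfracValue.
Variables (F : fieldType) (d : nat -> F) (t : F).
Hypothesis t0 : t != 0.

Lemma root_cfrac_diff (m : nat) : (forall k, (k < m)%N -> 1 + d k * t != 0) ->
  root (cfrac_diff d m) t =
    (t == \prod_(k < m) (1 + d k * t) ^ (if odd k then -2 else 2)).
Proof.
move=> l0; rewrite /cfrac_diff rootE hornerD hornerN subr_eq0.
set U := fun m => (cfrac d m).1.[t]; set V := fun m => (cfrac d m).2.[t].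
set Pi := fun m => \prod_(k < m) (1 + d k * t) ^ (if odd k then -2 else 2).
rewrite -/(U m) -/(V m) -/(Pi m).
(* [U / V] is [t / Pi] for even [m] and its inverse for odd [m]; in both cases it is 1 exactly when
   [t = Pi]. *)
suff [UVP U0 V0 P0] : [/\ if odd m then U m * t = V m * Pi m else U m * Pi m = t * V m,
    U m != 0, V m != 0 & Pi m != 0].
  case: (odd m) UVP => UVP; apply/eqP/eqP.
  - by move=> e; apply: (mulfI U0); rewrite UVP e.
  - by move=> e; apply: (mulIf t0); rewrite UVP -e.
  - by move=> e; apply: (mulIf V0); rewrite -UVP e mulrC.
  - by move=> e; apply: (mulIf P0); rewrite UVP -e mulrC.
elim: m l0 => [|l IHl] l0.
  by rewrite /U /V /Pi big_ord0 /= !hornerE t0 oner_neq0.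
have [e U0 V0 P0] := IHl (fun k kl => l0 k (ltnW kl)); have ll := l0 l (ltnSn l).
have US : U l.+1 = V l * (1 + d l * t) ^+ 2.
  by rewrite /U /V /= hornerM horner_exp !hornerE.
have VS : V l.+1 = U l by [].
have PS : Pi l.+1 = Pi l * (1 + d l * t) ^ (if odd l then -2 else 2).
  by rewrite /Pi big_ord_recr.
rewrite US VS PS; split; rewrite ?mulf_neq0 ?expf_neq0 //; last by rewrite expfz_neq0.
rewrite /=; case: (odd l) e => /= e; last first.
  by rewrite -exprnP [RHS]mulrA e; ring.
have -> : (1 + d l * t) ^ (-2) = ((1 + d l * t) ^+ 2)^-1 by rewrite -exprnN.
by rewrite mulrACA divff ?mulr1 ?expf_neq0 // -e mulrC.
Qed.

End CfracValue.

Section System.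
Variables (R : realType) (n m : nat) (d : nat -> R) (rs : seq R).
Hypotheses (m_gt0 : (0 < m)%N) (mn : (m <= n)%N) (d_gt0 : forall i, 0 < d i).
Hypotheses (size_rs : size rs = m.+1) (uniq_rs : uniq rs).
Hypotheses (rs_gt0 : forall r, r \in rs -> 0 < r) (root_rs : all (root (cfrac_diff d m)) rs).
Let mu (k : 'I_n) := alt_exp m k.

(* Row [j] of [red_coef] is the equation [x_j = 1 + d j * x^w], with [w] the last
   point; the invertible matrix with entries [1 + (j == k)] mixes the rows so that
   no coefficient vanishes. *)
Definition red_coef (j : 'I_n) : 'I_n.+2 -> R :=
  glue (-1) (fun k => (k == j)%:R) (- d j).

Definition sys_coef : 'M[R]_(n, n.+2) :=
  \matrix_(j, i) (red_coef j i + \sum_k red_coef k i).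

Lemma sys_coef_neq0 : supported_on sys_coef.
Proof.
move=> j i; rewrite mxE; elim/pt_ind: i => [|k|]; rewrite /red_coef.
- under eq_bigr do rewrite glueE.
  by rewrite glueE sumrN -opprD oppr_eq0 sumr_const card_ord -mulrS pnatr_eq0.
- under eq_bigr do rewrite glueE.
  rewrite glueE (bigD1 k) //= eqxx big1 ?addr0 => [|i ik]; last by rewrite eq_sym (negbTE ik).
  by rewrite -natrD addn1 pnatr_eq0.
- under eq_bigr do rewrite glueE.
  rewrite glueE sumrN -opprD oppr_eq0 gt_eqF // ltr_wpDr ?d_gt0 //.
  by apply: sumr_ge0 => k _; apply: ltW.
Qed.

(** * Solutions over an extension field, applied to [R] itself and to [R[i]] *)

Section Solutions.
Variables (F : numFieldType) (iota : {rmorphism R -> F}).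

Lemma lmono_cpt0 (x : 'rV[F]_n) : lmono x (cpt mu ord0) = 1.
Proof. by rewrite /lmono big1 // => k _; rewrite /cpt glueE mxE expr0z. Qed.

Lemma lmono_cpt_mid (x : 'rV[F]_n) k : lmono x (cpt mu (mid_pt k)) = x 0 k.
Proof.
rewrite /lmono (bigD1 k) //= big1 => [|i ik]; rewrite /cpt glueE mxE ?eqxx ?mulr1 //=.
by rewrite (negbTE ik) expr0z.
Qed.

Lemma lmono_cpt_max (x : 'rV[F]_n) : lmono x (cpt mu ord_max) = \prod_k x 0 k ^ mu k.
Proof. by rewrite /lmono; apply: eq_bigr => k _; rewrite /cpt glueE mxE. Qed.

Lemma sys_evalE (x : 'rV[F]_n) :
  (forall j, sys_eval (cpt mu) (map_mx iota sys_coef) x j = 0) <->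
  forall j, x 0 j = 1 + iota (d j) * \prod_k x 0 k ^ mu k.
Proof.
pose E j := x 0 j - 1 - iota (d j) * \prod_k x 0 k ^ mu k.
have redE j : \sum_i iota (red_coef j i) * lmono x (cpt mu i) = E j.
  rewrite sum_pt lmono_cpt0 lmono_cpt_max /red_coef !glueE.
  rewrite (bigD1 j) //= glueE eqxx lmono_cpt_mid big1 => [|k kj]; last first.
    by rewrite glueE (negbTE kj) rmorph0 mul0r.
  by rewrite !rmorphN !rmorph1 /E; ring.
have evalE j : sys_eval (cpt mu) (map_mx iota sys_coef) x j = E j + \sum_k E k.
  rewrite /sys_eval; under eq_bigr do rewrite !mxE rmorphD rmorph_sum mulrDl mulr_suml.
  rewrite big_split /= redE exchange_big; congr (_ + _).
  by apply: eq_bigr => k _; rewrite redE.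
split=> [h j|h j]; last first.
  have E0 k : E k = 0 by rewrite /E h; ring.
  by rewrite evalE E0 big1 ?addr0.
(* Summing the mixed equations gives [n + 1] times the sum of the [E k]; in characteristic 0 that
   sum vanishes, and then so does each [E j]. *)
have : \sum_j (E j + \sum_k E k) = 0.
  by apply: big1 => k _; rewrite -evalE.
rewrite big_split /= sumr_const card_ord -mulrS => /eqP; rewrite mulrn_eq0 /= => /eqP sE.
by have := h j; rewrite evalE sE addr0 /E => /eqP; rewrite -addrA -opprD subr_eq0 => /eqP.
Qed.

Definition root_sol (r : R) : 'rV[R]_n := \row_k (1 + d k * r).

Lemma root_sol_inj : injective root_sol.
Proof.
move=> r r' /rowP/(_ (Ordinal (leq_trans m_gt0 mn))); rewrite !mxE => /addrI.
by apply: mulfI; rewrite gt_eqF.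
Qed.

(** The degree is [m + 1] and [rs] already supplies that many distinct roots, so the extension field
    adds none. *)
Lemma root_map_cfrac_diff (t : F) :
  root (map_poly iota (cfrac_diff d m)) t -> t \in map iota rs.
Proof.
have [sf _] := cfrac_diff_size_lead m d_gt0.
move=> rt; apply: contraT => nt; have f0 : map_poly iota (cfrac_diff d m) != 0.
  by rewrite -size_poly_eq0 size_map_poly sf.
have /(_ (t :: map iota rs)) := max_poly_roots f0.
rewrite /= rt nt size_map_poly sf size_map size_rs ltnn => -> //.
  rewrite all_map; apply/allP => r /(allP root_rs) h /=.
  by rewrite fmorph_root.
by rewrite map_inj_uniq //; apply: fmorph_inj.
Qed.

Lemma map_cfrac k : cfrac (iota \o d) k =
  (map_poly iota (cfrac d k).1, map_poly iota (cfrac d k).2).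
Proof.
elim: k => [|k IHk] /=; first by rewrite map_polyX rmorph1.
by rewrite IHk /= rmorphM rmorphXn rmorphD rmorph1 /= map_polyZ map_polyX.
Qed.

Lemma root_sys (t : F) : t != 0 -> (forall k : 'I_n, 1 + iota (d k) * t != 0) ->
  root (map_poly iota (cfrac_diff d m)) t =
    (t == \prod_(k < n) (1 + iota (d k) * t) ^ mu k).
Proof.
move=> t0 l0; rewrite /cfrac_diff rmorphB /=.
have := root_cfrac_diff t0 (d := iota \o d) (m := m).
rewrite /cfrac_diff map_cfrac /= => -> => [|k km]; last exact: (l0 (Ordinal (leq_trans km mn))).
rewrite -(big_ord_ltn _ (fun k => (1 + iota (d k) * t) ^ (if odd k then -2 else 2)) mn) /=.
by congr (_ == _); apply: eq_bigr => k _; rewrite /mu /alt_exp; case: ifP.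
Qed.

(** A solution is determined by its value [t] of the monomial $x^w$, and consistency of [t] with
    [x_k = 1 + d k * t] is the univariate equation. *)
Lemma solutions (x : 'rV[F]_n) :
  x \in map (fun r => map_mx iota (root_sol r)) rs <->
  (forall j, x 0 j != 0) /\
  (forall j, sys_eval (cpt mu) (map_mx iota sys_coef) x j = 0).
Proof.
rewrite sys_evalE; split.
  move=> /mapP[r rrs ->].
  have r0 := rs_gt0 rrs; have t0 : iota r != 0 by rewrite fmorph_eq0 gt_eqF.
  have lE (k : 'I_n) : map_mx iota (root_sol r) 0 k = 1 + iota (d k) * iota r.
    by rewrite !mxE rmorphD rmorph1 rmorphM.
  have l0 (k : 'I_n) : 1 + iota (d k) * iota r != 0.
    rewrite -rmorphM -(rmorph1 iota) -rmorphD fmorph_eq0 gt_eqF //.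
    by rewrite addr_gt0 ?mulr_gt0.
  split=> j; first by rewrite lE l0.
  have := root_sys t0 l0; rewrite fmorph_root (allP root_rs) // => /esym/eqP e.
  by rewrite lE; congr (_ + _ * _); rewrite {1}e; apply: eq_bigr => k _; rewrite lE.
move=> [x0 xE]; set t := \prod_k _ in xE.
have t0 : t != 0 by apply/prodf_neq0 => k _; rewrite expfz_neq0.
have : root (map_poly iota (cfrac_diff d m)) t.
  rewrite root_sys // => [|k]; last by rewrite -xE.
  by rewrite {1}/t; apply/eqP/eq_bigr => k _; rewrite -xE.
move=> /root_map_cfrac_diff/mapP[r rrs tr]; apply/mapP; exists r => //.
by apply/rowP => k; rewrite xE tr !mxE rmorphD rmorph1 rmorphM.
Qed.

End Solutions.

Lemma num_pos_sol_sys : num_pos_sol (cpt mu) sys_coef m.+1.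
Proof.
exists (map root_sol rs); split; first by rewrite map_inj_uniq //; apply: root_sol_inj.
split; last by rewrite size_map.
have sol := @solutions R idfun; move=> x.
have -> : map root_sol rs = map (fun r => map_mx idfun (root_sol r)) rs.
  by apply: eq_map => r; rewrite map_mx_id.
split=> [xs|[x0 xE]]; last first.
  by apply/sol; split=> [j|]; [rewrite gt_eqF|rewrite map_mx_id].
split; last by have [_] := (sol x).1 xs; rewrite map_mx_id.
move=> j; have /mapP[r /rs_gt0 r0 ->] := xs.
by rewrite !mxE /= addr_gt0 ?mulr_gt0.
Qed.

Lemma generic_sys : generic_system (cpt mu) sys_coef.
Proof.
exists (map (fun r => map_mx (real_complex R) (root_sol r)) rs); split; [|split].
- rewrite map_inj_uniq // => r r' /rowP e; apply: root_sol_inj; apply/rowP => k.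
  by have := e k; rewrite !mxE => /fmorph_inj.
- move=> x; exact: solutions.
- rewrite size_map size_rs (@normalized_volume_cpt _ _ _ 2) ?card_cell_alt //.
    exact: leq_trans m_gt0 mn.
  exact: crel_alt_le.
Qed.

End System.

Theorem theorem3p6 (R : realType) (n m : nat) :
  (1 <= m <= n)%N ->
  exists (p : 'I_n.+2 -> 'rV[int]_n) (c : 'M[R]_(n, n.+2)),
    is_circuit p /\ circuit_m p m /\
    supported_on c /\ generic_system p c /\ num_pos_sol p c m.+1.
Proof.
move=> /andP[m0 mn].
have [d [rs [d0 size_rs uniq_rs rs0 root_rs]]] := cfrac_diff_roots R m.
pose mu (k : 'I_n) := alt_exp m k.
exists (cpt mu), (sys_coef n d); split; [split|split; [|split; [|split]]].
- apply: (@cpt_inj _ mu (Ordinal (leq_trans m0 mn))).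
  by rewrite /mu /alt_exp /= m0.
- apply: affdim_cpt => //; try by move=> *; rewrite finset.in_setT.
  by move=> i k _; rewrite leqNgt ltn_ord.
- apply: circuit_m_cpt => //; first by rewrite crel_alt0 //; case: ifP.
  by move=> k; rewrite /mu /alt_exp; case: ifP => // _; case: ifP.
- exact: sys_coef_neq0.
- exact: (@generic_sys R n m d rs).
- exact: (@num_pos_sol_sys R n m d rs).
Qed.
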